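(* Let $\mu$ be a positive measure on $\mathbb{R}$ with finite polynomial moments of all orders and infinitely many points of increase, let $\{p_k\}_{k\ge 0}$ be its orthonormal polynomials with positive leading coefficients, and let $(a_k)_{k\ge 1}\subset\mathbb{R}$ and $(b_k)_{k\ge 0}\subset(0,\infty)$ be its recurrence coefficients. Let $n\ge 0$, and set $\widetilde a_{n+1} := a_n$ and $\widetilde b_{n+1} := b_n$ (for $n=0$, $a_0$ denotes an arbitrary fixed real number). Let $\Delta a_{n+1}\in\mathbb{R}$ and $\Delta b_{n+1}>0$ be the corrections defined by $$a_{n+1} = \widetilde a_{n+1} + \Delta a_{n+1}, \qquad b_{n+1} = \widetilde b_{n+1}\,\Delta b_{n+1}.$$ Define polynomials $\widetilde p_{n+1}$ and $\hat p_{n+1}$ by $$\widetilde b_{n+1}\,\widetilde p_{n+1}(x) := (x-\widetilde a_{n+1})\,p_n(x) - b_n\, p_{n-1}(x), \qquad \widetilde b_{n+1}\,\hat p_{n+1}(x) := (x-a_{n+1})\,p_n(x) - b_n\, p_{n-1}(x),$$ and let $$G_{n,n+1} := \int_{\mathbb{R}} p_n(x)\,\widetilde p_{n+1}(x)\,d\mu(x), \qquad G_{n+1,n+1} := \int_{\mathbb{R}} \hat p_{n+1}(x)^2\,d\mu(x).$$ Then $$\Delta a_{n+1} = G_{n,n+1}\, b_n, \qquad \Delta b_{n+1} = \sqrt{G_{n+1,n+1}}.$$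
   Context: For a positive measure $\mu$ on $\mathbb{R}$ with finite moments of all orders and infinitely many points of increase, the orthonormal polynomials $\{p_k\}_{k\ge0}$ are the unique polynomials with $\deg p_k = k$, positive leading coefficient, and $\int_{\mathbb{R}} p_k p_m\,d\mu = \delta_{k,m}$. The recurrence coefficients $(a_k)_{k\ge1}\subset\mathbb{R}$ and $(b_k)_{k\ge0}\subset(0,\infty)$ of $\mu$ are the numbers for which $$x\,p_k(x) = b_k\,p_{k-1}(x) + a_{k+1}\,p_k(x) + b_{k+1}\,p_{k+1}(x), \qquad k\ge 0,$$ with the conventions $p_{-1}\equiv 0$ and $p_0 = 1/b_0$ (so $b_0 = \mu(\mathbb{R})^{1/2}$). *)

(* Defs.v *)
From HB Require Import structures.
From mathcomp Require Import all_boot all_order all_algebra.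
From mathcomp Require Import all_classical all_reals all_analysis.

Set Implicit Arguments.
Unset Strict Implicit.
Unset Printing Implicit Defensive.

Import Order.TTheory GRing.Theory Num.Theory.
Local Open Scope classical_set_scope.
Local Open Scope ring_scope.

Section OrthonormalPolynomials.
Variable R : realType.
Implicit Types (mu : {measure set (measurableTypeR R) -> \bar R})
  (p q : {poly R}) (P : nat -> {poly R}).

(* The case [k = 0] makes [mu] a finite measure. *)
Definition finite_moments mu : Prop :=
  forall k : nat, mu.-integrable setT (fun x : R => (x ^+ k)%:E).

Definition points_of_increase mu : set R :=
  [set x : R | forall e : R, 0 < e -> (0 < mu `](x - e)%R, (x + e)%R[%classic)%E].

Definition poly_dot mu p q : R := \int[mu]_x (p.[x] * q.[x]).

Record orthonormal_polys mu P : Prop := OrthonormalPolys {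
  orthonormal_size : forall k, size (P k) = k.+1;
  orthonormal_lead_coef : forall k, 0 < lead_coef (P k);
  orthonormal_dot : forall k m, poly_dot mu (P k) (P m) = (k == m)%:R }.

(* [prev_poly P k] is p_(k-1), with the convention p_(-1) = 0. *)
Definition prev_poly P (k : nat) : {poly R} := if k is j.+1 then P j else 0.

(* Only [a k] with [k >= 1] is a recurrence coefficient: [a 0] occurs in none
   of the conditions, so it is an arbitrary real number. *)
Record recurrence_coefs P (a b : nat -> R) : Prop := RecurrenceCoefs {
  recurrence_gt0 : forall k, 0 < b k;
  recurrence_init : P 0 = (1 / b 0)%:P;
  recurrence_step : forall k,
    'X * P k = b k *: prev_poly P k + a k.+1 *: P k + b k.+1 *: P k.+1 }.

End OrthonormalPolynomials.

(* Main.v *)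
(* Comparing with the three-term recurrence, [tp = Db *: p n.+1 + (Da / b n) *: p n]
   and [hp = Db *: p n.+1]; both identities then follow from orthonormality, the
   sign of the square root being fixed by [0 < Db]. *)
Require Import Defs.
From HB Require Import structures.
From mathcomp Require Import all_boot all_order all_algebra.
From mathcomp Require Import all_classical all_reals all_analysis.
From mathcomp Require Import ring.

Import Order.TTheory GRing.Theory Num.Theory.
Local Open Scope classical_set_scope.
Local Open Scope ring_scope.

(** Each monomial is integrable by the moment hypothesis, and a polynomial is a finite linear
    combination of monomials. *)
Lemma integrable_horner (R : realType)
  (mu : {measure set (measurableTypeR R) -> \bar R}) (q : {poly R}) :
  finite_moments mu -> mu.-integrable setT (fun x : R => q.[x]%:E).
Proof.
move=> mu_moments.
rewrite (_ : (fun _ => _) =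
  fun x : R => (\sum_(i < size q) (q`_i)%:E * (x ^+ i)%:E)%E).
  apply: (@integrable_sum _ (measurableTypeR R)) => // i _.
  exact: (@integrableZl _ (measurableTypeR R)).
by apply/funext => x; rewrite horner_coef -sumEFin.
Qed.

(** Splitting the integral requires integrable summands; these are polynomials, as products of
    polynomials are. *)
Lemma poly_dotDZr (R : realType)
  (mu : {measure set (measurableTypeR R) -> \bar R}) (c d : R)
  (q r s : {poly R}) :
  finite_moments mu ->
  poly_dot mu q (c *: r + d *: s) = c * poly_dot mu q r + d * poly_dot mu q s.
Proof.
move=> mu_moments.
have int_mul u v : mu.-integrable setT (EFin \o (fun x : R => u.[x] * v.[x])).
  rewrite (_ : _ \o _ = fun x : R => (u * v).[x]%:E).
    exact: integrable_horner.
  by apply/funext => x /=; rewrite hornerM.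
(* [int_mul] justifies pulling the scalars out, [int_mulZ] splitting the sum of scaled terms. *)
have int_mulZ e u v :
    mu.-integrable setT (EFin \o (fun x : R => e * (u.[x] * v.[x]))).
  rewrite (_ : _ \o _ = EFin \o (fun x : R => (e *: u).[x] * v.[x])).
    exact: int_mul.
  by apply/funext => x /=; rewrite hornerZ mulrA.
rewrite /poly_dot -!(@RintegralZl _ (measurableTypeR R)) //.
rewrite -(@RintegralD _ (measurableTypeR R)) //.
by apply: eq_Rintegral => x _; rewrite hornerD !hornerZ; ring.
Qed.

Theorem lemma3p1 (R : realType)
  (mu : {measure set (measurableTypeR R) -> \bar R})
  (mu_moments : finite_moments mu)
  (mu_increase : infinite_set (points_of_increase mu))
  (p : nat -> {poly R}) (p_orthonormal : orthonormal_polys mu p)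
  (a b : nat -> R) (ab_recurrence : recurrence_coefs p a b)
  (n : nat)
  (ta tb : R) (ta_def : ta = a n) (tb_def : tb = b n)
  (Da Db : R) (Db_gt0 : 0 < Db)
  (Da_def : a n.+1 = ta + Da) (Db_def : b n.+1 = tb * Db)
  (tp hp : {poly R})
  (tp_def : tb *: tp = ('X - ta%:P) * p n - b n *: prev_poly p n)
  (hp_def : tb *: hp = ('X - (a n.+1)%:P) * p n - b n *: prev_poly p n)
  (G_n_n1 G_n1_n1 : R)
  (G_n_n1_def : G_n_n1 = \int[mu]_x ((p n).[x] * tp.[x]))
  (G_n1_n1_def : G_n1_n1 = \int[mu]_x (hp.[x] ^+ 2)) :
  Da = G_n_n1 * b n /\ Db = Num.sqrt G_n1_n1.
Proof.
have [_ _ dotp] := p_orthonormal; have [b_gt0 _ Xp] := ab_recurrence.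
have bn_neq0 : b n != 0 by rewrite gt_eqF.
(* [tp] and [hp] are known only through their multiples by [b n], so identities are checked after
   scaling. *)
have scale_inj (u v : {poly R}) : b n *: u = b n *: v -> u = v.
  by move=> /(congr1 (GRing.scale (b n)^-1)); rewrite !scalerK.
subst tb.
have tpE : tp = Db *: p n.+1 + (Da / b n) *: p n.
  (* Expanding ['X * p n] cancels the [prev_poly] term; [a n.+1 - a n] leaves [Da *: p n]. *)
  apply: scale_inj; rewrite tp_def mulrBl Xp mul_polyC scalerDr !scalerA.
  (* The division is cleared first; scalars then become constant polynomials so that [ring] applies
     in [{poly R}]. *)
  by rewrite Db_def Da_def [b n * (Da / _)]mulrC divfK // -!mul_polyC !rmorphD /=; ring.
have hpE : hp = Db *: p n.+1.
  apply: scale_inj; rewrite hp_def mulrBl Xp mul_polyC scalerA Db_def.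
  by rewrite -!mul_polyC; ring.
split.
  (* Pairing with [p n] kills the [p n.+1] component and leaves [Da / b n]. *)
  rewrite G_n_n1_def -/(poly_dot mu (p n) tp) tpE poly_dotDZr // !dotp.
  by rewrite eqxx ltn_eqF // mulr0 add0r mulr1 divfK.
suff -> : G_n1_n1 = Db ^+ 2 by rewrite sqrtr_sqr gtr0_norm.
(* Both factors [Db] move to the right argument, and [0 *: 0] pads it to the two-term shape of
   [poly_dotDZr]. *)
rewrite G_n1_n1_def; transitivity (poly_dot mu (p n.+1) (Db ^+ 2 *: p n.+1 + 0 *: 0)).
  by apply: eq_Rintegral => x _; rewrite hpE hornerD !hornerZ; ring.
by rewrite poly_dotDZr // dotp eqxx mul0r addr0 mulr1.
Qed.
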